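(* Let $\Sigma^*\to G$, $w\mapsto \overline{w}$, be a choice of generators for a group $G$, and let $\#$ be a letter not in $\Sigma$. Then $G$ is word hyperbolic if and only if there exists a regular combing $R\subset\Sigma^*$ such that the language $$M=\{u\#v\#w \mid u,v,w\in R,\ \overline{u}\,\overline{v}\,\overline{w}=1\}\subset(\Sigma\cup\{\#\})^*$$ is context-free.
   Context: A choice of generators for a group $G$ consists of a finite alphabet $\Sigma$ equipped with formal inverses (a permutation $a\mapsto a^{-1}$ of $\Sigma$ all of whose orbits have length two, extended to $\Sigma^*$ by $(wv)^{-1}=v^{-1}w^{-1}$) together with a surjective monoid homomorphism $\Sigma^*\to G$, $w\mapsto\overline{w}$, satisfying $\overline{w^{-1}}=\overline{w}^{-1}$. A combing is a language $R\subset\Sigma^*$ whose image under $w\mapsto\overline w$ is all of $G$; it is a regular combing if $R$ is a regular language. Word hyperbolicity is with respect to the word metric on $G$ determined by the generators. *)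

(* Defs.v *)
From Stdlib Require Import ClassicalEpsilon.
From HB Require Import structures.
From mathcomp Require Import all_boot.

Set Implicit Arguments.
Unset Strict Implicit.
Unset Printing Implicit Defensive.

Local Open Scope group_scope.

Definition language (A : Type) := seq A -> Prop.

Record dfa (A : finType) := Dfa {
  dfa_state : finType;
  dfa_start : dfa_state;
  dfa_trans : dfa_state -> A -> dfa_state;
  dfa_accept : pred dfa_state }.

Definition dfa_accepts (A : finType) (D : dfa A) (w : seq A) : bool :=
  @dfa_accept A D (foldl (@dfa_trans A D) (@dfa_start A D) w).

Definition regular (A : finType) (L : language A) : Prop :=
  exists D : dfa A, forall w, L w <-> dfa_accepts D w.

Record cfg (A : finType) := Cfg {
  cfg_nt : finType;
  cfg_start : cfg_nt;
  cfg_prods : seq (cfg_nt * seq (A + cfg_nt)) }.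

Section Derivation.
Variables (A : finType) (Gr : cfg A).

Inductive gen_sym : A + cfg_nt Gr -> seq A -> Prop :=
  | gen_term (a : A) : gen_sym (inl a) [:: a]
  | gen_nonterm (X : cfg_nt Gr) (rhs : seq (A + cfg_nt Gr)) (w : seq A) :
      (X, rhs) \in @cfg_prods A Gr -> gen_seq rhs w -> gen_sym (inr X) w
with gen_seq : seq (A + cfg_nt Gr) -> seq A -> Prop :=
  | gen_nil : gen_seq [::] [::]
  | gen_cons s r u v : gen_sym s u -> gen_seq r v -> gen_seq (s :: r) (u ++ v).

Definition cfg_language : language A := fun w => gen_sym (inr (@cfg_start A Gr)) w.
End Derivation.

Definition context_free (A : finType) (L : language A) : Prop :=
  exists Gr : cfg A, forall w, L w <-> cfg_language Gr w.

Definition evalw (G : groupType) (Sigma : Type) (phi : Sigma -> G) (w : seq Sigma) : G :=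
  foldr (fun a g => phi a * g) 1 w.

Definition winv (Sigma : Type) (inv : Sigma -> Sigma) (w : seq Sigma) : seq Sigma :=
  rev (map inv w).

Definition choice_of_generators (G : groupType) (Sigma : finType)
    (inv : Sigma -> Sigma) (phi : Sigma -> G) : Prop :=
  [/\ involutive inv, (forall a, inv a != a),
      (forall w, evalw phi (winv inv w) = (evalw phi w)^-1) &
      (forall g : G, exists w, evalw phi w = g)].

Definition combing (G : groupType) (Sigma : finType) (phi : Sigma -> G)
    (R : language Sigma) : Prop :=
  forall g : G, exists w, R w /\ evalw phi w = g.

Definition regular_combing (G : groupType) (Sigma : finType) (phi : Sigma -> G)
    (R : language Sigma) : Prop :=
  regular R /\ combing phi R.

Definition is_word_length (G : groupType) (Sigma : Type) (phi : Sigma -> G)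
    (g : G) (n : nat) : Prop :=
  (exists w, size w = n /\ evalw phi w = g) /\
  (forall w, evalw phi w = g -> n <= size w).

Definition word_length (G : groupType) (Sigma : Type) (phi : Sigma -> G) (g : G) : nat :=
  epsilon (inhabits 0) (is_word_length phi g).

Definition word_dist (G : groupType) (Sigma : Type) (phi : Sigma -> G) (g h : G) : nat :=
  word_length phi (g^-1 * h).

(* twice the Gromov product (x|y)_w = (d(x,w) + d(y,w) - d(x,y)) / 2 *)
Definition gromov2 (G : groupType) (Sigma : Type) (phi : Sigma -> G) (x y w : G) : nat :=
  word_dist phi x w + word_dist phi y w - word_dist phi x y.

(* Gromov's definition of delta-hyperbolicity of (G, word metric):
   (x|z)_w >= min((x|y)_w, (y|z)_w) - delta  for all x y z w. *)
Definition word_hyperbolic (G : groupType) (Sigma : Type) (phi : Sigma -> G) : Prop :=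
  exists delta : nat, forall x y z w : G,
    minn (gromov2 phi x y w) (gromov2 phi y z w) <= (gromov2 phi x z w + 2 * delta)%N.

Definition hash_word (Sigma : Type) (u v w : seq Sigma) : seq (option Sigma) :=
  map Some u ++ None :: map Some v ++ None :: map Some w.

Definition triangle_language (G : groupType) (Sigma : finType) (phi : Sigma -> G)
    (R : language Sigma) : language (option Sigma) :=
  fun x => exists u v w, [/\ R u, R v, R w,
    evalw phi u * evalw phi v * evalw phi w = 1 & x = hash_word u v w].

(* Main.v *)
(* From a hyperbolic group to a context-free triangle language, R is the set of
   geodesic words. It is regular because the cone of a group element g is
   determined by the function h |-> |gh| - |g| on a fixed ball. By the four point
   inequality, geodesic triangles can be cut into small triangles, that is, they
   are derived by the context-free grammar of all true relations between elements
   of a fixed ball, refined by the states of an automaton for R#R#R.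

   Conversely, every nonterminal that occurs in a derivation of a triangle has a
   constant value in G, so a derivation tree cuts the triangle by short chords. If
   the sides are shortest representatives in R, the subtrees without # are bounded
   as well, since they can be replaced by short ones, and the triangles are slim.
   Slim triangles for one family of connected lines between any two points force
   hyperbolicity, the lines being uniformly close to geodesics (Bowditch's
   "guessing geodesics" criterion). *)

From Stdlib Require Import ClassicalEpsilon.
Require Import Defs.
From HB Require Import structures.
From mathcomp Require Import all_boot zify.

Set Implicit Arguments.
Unset Strict Implicit.
Unset Printing Implicit Defensive.

(** * Least witnesses and factorizations of lists *)

Lemma ex_least (P : nat -> Prop) :
  (exists n, P n) -> exists n, P n /\ forall m, P m -> n <= m.
Proof.
case=> n; elim/ltn_ind: n => n IHn Pn.
have [[m [m_lt_n Pm]]|no_smaller] := classic (exists m, m < n /\ P m).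
  exact: IHn Pm.
exists n; split=> // m Pm; rewrite leqNgt; apply/negP => m_lt_n.
by apply: no_smaller; exists m.
Qed.

Lemma cat_eq_cat (A : Type) (s1 s2 t1 t2 : seq A) : s1 ++ s2 = t1 ++ t2 ->
  (exists r, s1 = t1 ++ r /\ t2 = r ++ s2) \/
  (exists r, t1 = s1 ++ r /\ s2 = r ++ t2).
Proof.
elim: s1 t1 => [|a s1 IHs] [|b t1] /= sE.
- by left; exists [::].
- by right; exists (b :: t1).
- by left; exists (a :: s1).
case: sE => <- /IHs [[r [-> ->]]|[r [-> ->]]]; [left|right]; by exists r.
Qed.

Lemma map_eq_cat (A B : Type) (f : A -> B) s t1 t2 : map f s = t1 ++ t2 ->
  exists s1 s2, [/\ s = s1 ++ s2, map f s1 = t1 & map f s2 = t2].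
Proof.
move=> sE; exists (take (size t1) s), (drop (size t1) s).
by rewrite cat_take_drop map_take map_drop sE take_size_cat // drop_size_cat.
Qed.

(** * Slim lines force hyperbolicity *)

Section GuessingGeodesics.

Variables (X : Type) (d : X -> X -> nat) (L : X -> X -> X -> Prop) (h : nat).
Hypotheses (d_refl : forall x, d x x = 0) (d_sym : forall x y, d x y = d y x)
  (d_triangle : forall x y z, d x z <= d x y + d y z)
  (d_geodesic : forall x y k, k <= d x y ->
     exists z, d x z = k /\ d z y = d x y - k).
Hypotheses
  (L_connected : forall x y (P Q : X -> Prop),
     (forall p, L x y p -> P p \/ Q p) -> P x -> Q y ->
     exists p q, [/\ L x y p, L x y q, P p, Q q & d p q <= 1])
  (L_slim : forall x y z p, L x y p ->
     exists q, (L x z q \/ L z y q) /\ d p q <= h)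
  (L_short : forall x y p, d x y <= 1 -> L x y p -> d p x <= h).

Definition near_interval (x y p : X) (t : nat) : Prop :=
  exists q, d x q + d q y = d x y /\ d p q <= t.

(** Bisect [k] times: each midpoint costs one use of slimness, hence one [h], and [L_short] ends the
    recursion. *)
Lemma near_interval_log k x y p :
  d x y <= 2 ^ k -> L x y p -> near_interval x y p (k.+1 * h).
Proof.
elim: k x y p => [|k IHk] x y p dxy Lp.
  exists x; split; first by rewrite d_refl.
  by have := L_short dxy Lp; lia.
have half : (d x y)./2 <= d x y by lia.
have [m [dxm dmy]] := d_geodesic half.
rewrite expnS in dxy.
have [q [Lq dpq]] := L_slim m Lp.
have [r [r_mid dqr]] : exists r, (d x r + d r m = d x m \/
    d m r + d r y = d m y) /\ d q r <= k.+1 * h.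
  have [dxm2 dmy2] : d x m <= 2 ^ k /\ d m y <= 2 ^ k by lia.
  case: Lq => Lq.
    by have [r [? ?]] := IHk _ _ _ dxm2 Lq; exists r; split; [left|].
  by have [r [? ?]] := IHk _ _ _ dmy2 Lq; exists r; split; [right|].
exists r; split; last by have := d_triangle p q r; rewrite (mulSn k.+1); lia.
have := d_triangle x r y; have := d_triangle r m y; have := d_triangle x m r.
by case: r_mid; lia.
Qed.

(** In the application [6 * t] bounds the distance between two subdivision points, and [k.+3 * h] is
    the logarithmic bound [k.+1 * h] plus two slimness steps. *)
Lemma exp_beats_linear : exists T, forall t, T < t ->
  exists k, 6 * t <= 2 ^ k /\ k.+3 * h < t.
Proof.
exists (192 * h.+1 * h.+1 + 8 * h.+1) => t T_lt_t.
pose m := t %/ (4 * h.+1).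
have m_ge : m >= 48 * h.+1 by rewrite leq_divRL //; nia.
have t_ge : m * (4 * h.+1) <= t by exact: leq_divM.
have t_lt : t < m.+1 * (4 * h.+1) by rewrite ltn_ceil.
(* [2 ^ (m + m)] exceeds [m * m], which is quadratic in [t]. *)
exists (m + m); split; last by nia.
rewrite expnD.
have m_lt : m < 2 ^ m by exact: ltn_expl.
have : 6 * t <= m * m by nia.
by nia.
Qed.

(* A point of [L x y] at distance t from the interval is, after subdividing at
   points a, b of the interval at distance 3t on each side of the projection,
   close to [L a b], where the logarithmic bound applies, or to [L x a] or
   [L b y], which the induction keeps too close to far away intervals. *)
Lemma L_near_interval :
  exists T, forall x y p, L x y p -> near_interval x y p T.
Proof.
have [T0 T0P] := exp_beats_linear.
exists (T0 + 4 * h) => x y p.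
move: {2}(d x y) (leqnn (d x y)) => n; elim: n x y p => [|n IHn] x y p dxy Lp.
  exists x; split; first by rewrite d_refl.
  by have := L_short _ Lp; lia.
have [t [[q [q_mid dpq]] t_min]] : exists t, near_interval x y p t /\
    forall s, near_interval x y p s -> t <= s.
  by apply: ex_least; exists (d p x); exists x; rewrite d_refl.
have {t_min} far r : d x r + d r y = d x y -> t <= d p r.
  by move=> r_mid; apply: t_min; exists r.
suff t_le : t <= T0 + 4 * h by exists q; split=> //; lia.
rewrite leqNgt; apply/negP => t_gt.
(* The minimum covers a projection [q] close to an end: then [a] is at distance 0 from [x], or [b]
   from [y], and [L_short] replaces the induction. *)
have step_x : minn (3 * t) (d x q) <= d q x by rewrite (d_sym q x) geq_minr.
have step_y : minn (3 * t) (d q y) <= d q y by rewrite geq_minr.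
have [a [dqa dax]] := d_geodesic step_x.
have [b [dqb dby]] := d_geodesic step_y.
rewrite (d_sym q x) in dax.
have [r [Lr dpr]] : exists r, (L x a r \/ L a b r \/ L b y r) /\ d p r <= 2 * h.
  have [r [Lr dpr]] := L_slim a Lp.
  case: Lr => [Lr|Lr]; first by exists r; split; [left | lia].
  have [s [Ls drs]] := L_slim b Lr.
  exists s; split; first by right.
  by have := d_triangle p r s; lia.
case: Lr => [Lr|[Lr|Lr]].
- have [xa_small|xa_big] := leqP (d x q) (3 * t).
    have ax : d x a <= 1 by rewrite d_sym; lia.
    have := far x; rewrite d_refl => /(_ erefl).
    by have := L_short ax Lr; have := d_triangle p r x; lia.
  (* Points between [x] and [a] are at distance at least [3 * t] from [q], hence [2 * t] from [p],
     but induction puts one within [T0 + 6 * h] of [p]. *)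
  have [s [s_mid drs]] := IHn x a r ltac:(have := d_sym x a; lia) Lr.
  have := far s; have := d_triangle p r s; have := d_triangle x s q.
  have := d_triangle s p q; have := d_sym s p; have := d_sym a q.
  have := d_sym x a; have := d_triangle s a q; have := d_triangle s q y.
  by have := d_triangle x s y; lia.
- have [k [k_big k_small]] := T0P t ltac:(lia).
  have ab : d a b <= 2 ^ k.
    by have := d_triangle a q b; have := d_sym a q; lia.
  have [s [s_mid drs]] := near_interval_log ab Lr.
  have := far s; have := d_triangle p r s; have := d_triangle x s y.
  have := d_triangle x a s; have := d_triangle s b y; have := d_triangle a q b.
  have := d_sym a q; have := d_sym x a.
  have := mulSn k.+2 h; have := mulSn k.+1 h.
  by lia.
- have [by_small|by_big] := leqP (d q y) (3 * t).
    have by1 : d b y <= 1 by lia.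
    have := far y; rewrite d_refl addn0 => /(_ erefl).
    have := L_short by1 Lr; have := d_triangle p r b; have := d_triangle p b y.
    by lia.
  have [s [s_mid drs]] := IHn b y r ltac:(lia) Lr.
  have := far s; have := d_triangle p r s; have := d_triangle q s y.
  have := d_triangle s p q; have := d_sym s p; have := d_sym s q.
  have := d_triangle q b s; have := d_triangle x q s.
  by have := d_triangle x s y; lia.
Qed.

(* Twice the Gromov product (x|y)_w, which is comparable with the distance from
   w to [L x y]. *)
Let g2 x y w := d x w + d y w - d x y.

Theorem guessing_geodesics : exists delta, forall x y z w,
  minn (g2 x y w) (g2 y z w) <= g2 x z w + 2 * delta.
Proof.
have [T T_near] := L_near_interval.
have upper x y w p : L x y p -> g2 x y w <= 2 * (d p w + T).
  move=> /T_near [q [q_mid dpq]]; rewrite /g2.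
  have := d_triangle x q w; have := d_triangle y q w; have := d_triangle q p w.
  have := d_sym q p; have := d_sym y q; lia.
(* By slimness each point of [L x y] is near an interval from [w] to [x] or to [y]; connectedness
   gives adjacent points near one of each, and these are close enough to [w]. *)
have lower x y w : exists p, L x y p /\ 2 * d p w <= g2 x y w + 4 * (T + h + 1).
  have [|||p [q [Lp Lq [r [r_mid dpr]] [s [s_mid dqs]] dpq]]] :=
    @L_connected x y (fun p => near_interval x w p (T + h))
                     (fun p => near_interval w y p (T + h)).
  - move=> p /(L_slim w) [q [[Lq|Lq] dpq]]; [left|right];
      have [r [r_mid dqr]] := T_near _ _ _ Lq; exists r; split=> //;
      by have := d_triangle p q r; lia.
  - by exists x; rewrite d_refl.
  - by exists y; rewrite d_refl addn0.
  exists p; split=> //; rewrite /g2.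
  have := d_triangle x r p; have := d_triangle p r w; have := d_sym r p.
  have := d_triangle p q s; have := d_triangle p s w; have := d_triangle p s y.
  by have := d_triangle x p y; have := d_sym s w; have := d_sym y w; lia.
exists (2 * (T + h + 1) + 2 * (T + h)) => x y z w.
have [p [Lp p_near]] := lower x z w.
have [q [[Lq|Lq] dpq]] := L_slim y Lp; have := upper _ _ w _ Lq;
  by have := d_triangle q p w; have := d_sym q p; lia.
Qed.

End GuessingGeodesics.

(** * Short yields of grammars, and regularity from finite colorings *)

Lemma ex_common_bound (I : finType) (P : I -> nat -> Prop) :
  exists C, forall i n, P i n -> exists m, P i m /\ m <= C.
Proof.
exists (\max_i epsilon (inhabits 0) (P i)) => i n Pin.
exists (epsilon (inhabits 0) (P i)); split; last exact: leq_bigmax.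
by apply: epsilon_spec; exists n.
Qed.

Scheme gen_sym_mut := Minimality for gen_sym Sort Prop
  with gen_seq_mut := Minimality for gen_seq Sort Prop.
Combined Scheme gen_mutind from gen_sym_mut, gen_seq_mut.

Section Yields.

Variables (A : finType) (Gr : cfg A).

(** One yield is fixed for each of the finitely many productive nonterminals; the successor in
    [C.+1] makes room for terminals, whose yields have length 1. *)
Lemma short_yields : exists C, 0 < C /\
  (forall s x, gen_sym (Gr := Gr) s x ->
     exists y, gen_sym (Gr := Gr) s y /\ size y <= C) /\
  (forall r x, gen_seq (Gr := Gr) r x ->
     exists y, gen_seq (Gr := Gr) r y /\ size y <= size r * C).
Proof.
have [C CP] := @ex_common_bound (cfg_nt Gr)
  (fun Y n => exists x, gen_sym (Gr := Gr) (inr Y) x /\ size x = n).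
have sym_short s x : gen_sym (Gr := Gr) s x ->
    exists y, gen_sym (Gr := Gr) s y /\ size y <= C.+1.
  case: s => [a _|Y gx]; first by exists [:: a]; split; [constructor|].
  have [|_ [[y [gy <-]] y_le]] := CP Y (size x); first by exists x.
  by exists y; split; last exact: leqW.
exists C.+1; split=> //; split=> // r x; elim=> [|s r' u v gu _ [v' [gv' v'_le]]].
  by exists [::]; split; first constructor.
have [u' [gu' u'_le]] := sym_short _ _ gu.
exists (u' ++ v'); split; first by constructor.
by rewrite size_cat mulSn leq_add.
Qed.

End Yields.

(** One half of Myhill-Nerode: the colors are the states, and a transition appends the letter to a
    chosen word of the given color. *)
Lemma regular_of_coloring (A S : finType) (color : seq A -> S) (L : language A) :
  (forall u v, color u = color v -> forall w, L (u ++ w) <-> L (v ++ w)) ->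
  regular L.
Proof.
move=> colorP; pose rep s := epsilon (inhabits [::]) (fun u => color u = s).
have rep_color u w : L (rep (color u) ++ w) <-> L (u ++ w).
  apply: colorP; rewrite /rep; apply: (@epsilon_spec _ _ (fun v => color v = _)).
  by exists u.
pose accept s := if excluded_middle_informative (L (rep s)) then true else false.
exists (Dfa (color [::]) (fun s a => color (rcons (rep s) a)) accept) => w.
rewrite /dfa_accepts /=; set run := foldl _ _.
(* [color] need not be compatible with appending letters, so [run w] may differ from [color w]; only
   the continuations into [L] agree. *)
have runP z : L (w ++ z) <-> L (rep (run w) ++ z).
  rewrite /run; elim/last_ind: w z => [|w a IHw] z /=; first by rewrite rep_color.
  by rewrite cat_rcons IHw foldl_rcons rep_color cat_rcons.
have := runP [::]; rewrite !cats0 => ->.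
by rewrite /accept; case: excluded_middle_informative.
Qed.

(** * An automaton for three words of a regular language separated by # *)

Section HashAutomaton.

Variables (A : finType) (D : dfa A).

Definition hash_trans (s : option ('I_3 * dfa_state D)) (x : option A) :=
  match s, x with
  | Some (i, q), Some a => Some (i, dfa_trans q a)
  | Some (i, q), None =>
      if dfa_accept q && (i < 2) then Some (inord i.+1, dfa_start D) else None
  | None, _ => None
  end.

Definition hash_dfa : dfa (option A) :=
  Dfa (Some (ord0, dfa_start D)) hash_trans
    (fun s => if s is Some (i, q) then (i == 2 :> nat) && dfa_accept q else false).

(** What remains to be read in state [q] with [n] separators to come; this generality allows
    induction on the word. *)
Fixpoint hash_split (n : nat) (q : dfa_state D) (X : seq (option A)) : Prop :=
  if n is n'.+1 then
    exists u Y, [/\ X = map Some u ++ None :: Y,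
                    dfa_accept (foldl (@dfa_trans _ D) q u)
                  & hash_split n' (dfa_start D) Y]
  else exists u, X = map Some u /\ dfa_accept (foldl (@dfa_trans _ D) q u).

Lemma hash_split_nil n q : hash_split n q [::] <-> n = 0 /\ dfa_accept q.
Proof.
case: n => [|n] /=; last first.
  by split=> [[[|a u] [Y []]]|[]].
by split=> [[[|a u] []]|[_ qF]] //; exists [::].
Qed.

Lemma hash_split_Some n q a X :
  hash_split n q (Some a :: X) <-> hash_split n (dfa_trans q a) X.
Proof.
case: n => [|n] /=; split.
- by move=> [[|b u] [//= [<- ->] uF]]; exists u.
- by move=> [u [-> uF]]; exists (a :: u).
- by move=> [[|b u] [Y [//= [<- ->] uF YF]]]; exists u, Y.
by move=> [u [Y [-> uF YF]]]; exists (a :: u), Y.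
Qed.

Lemma hash_split_None n q X : hash_split n q (None :: X) <->
  [/\ dfa_accept q, 0 < n & hash_split n.-1 (dfa_start D) X].
Proof.
case: n => [|n] /=; split.
- by move=> [[|a u] []].
- by case.
- by move=> [[|a u] [Y [//= [<-] qF]]].
by move=> [qF _ XF]; exists [::], X.
Qed.

Lemma hash_dfa_split X :
  dfa_accepts hash_dfa X <-> hash_split 2 (dfa_start D) X.
Proof.
rewrite /dfa_accepts; set acc := @dfa_accept _ hash_dfa; rewrite /=.
have dead Y : foldl hash_trans None Y = None by elim: Y.
suff accP n q : n < 3 -> acc (foldl hash_trans (Some (inord n, q)) X) <->
    hash_split (2 - n) q X.
  by rewrite (_ : ord0 = inord 0); [exact: accP | apply/val_inj; rewrite /= inordK].
rewrite /acc; elim: X n q => [|[a|] X IHX] n q n_lt /=.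
- rewrite hash_split_nil inordK //; split=> [/andP[/eqP-> ->]//|[n2 ->]].
  by rewrite andbT; lia.
- by rewrite IHX // hash_split_Some.
rewrite hash_split_None inordK //.
case: ifP => [/andP[-> n_lt1]|no].
  rewrite IHX; last by lia.
  by rewrite (_ : 2 - n.+1 = (2 - n).-1) ?subn_gt0 //; [split=> [|[]]|lia].
by rewrite dead; split=> // -[qF n_lt1]; rewrite qF /= in no; lia.
Qed.

Lemma hash_dfaP X : dfa_accepts hash_dfa X <->
  exists u v w, [/\ dfa_accepts D u, dfa_accepts D v, dfa_accepts D w
                  & X = hash_word u v w].
Proof.
rewrite hash_dfa_split /=; split.
  by move=> [u [_ [-> uF [v [_ [-> vF [w [-> wF]]]]]]]]; exists u, v, w.
move=> [u [v [w [uF vF wF ->]]]]; exists u, (map Some v ++ None :: map Some w).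
by split=> //; exists v, (map Some w); split=> //; exists w.
Qed.

End HashAutomaton.

(** * The word metric *)

Section Words.

Variable G : groupType.

Lemma evalw_cat (A : Type) (f : A -> G) u v :
  evalw f (u ++ v) = (evalw f u * evalw f v)%g.
Proof. by elim: u => [|a u IHu] /=; rewrite ?mul1g // IHu mulgA. Qed.

Lemma evalw_rcons (A : Type) (f : A -> G) u a :
  evalw f (rcons u a) = (evalw f u * f a)%g.
Proof. by rewrite -cats1 evalw_cat /= mulg1. Qed.

Variables (A : Type) (f : A -> G).

Lemma evalw_Some u : evalw (oapp f 1%g) (map Some u) = evalw f u.
Proof. by elim: u => //= a u ->. Qed.

Lemma evalw_hash_word u v w : evalw (oapp f 1%g) (hash_word u v w) =
  (evalw f u * evalw f v * evalw f w)%g.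
Proof.
rewrite /hash_word evalw_cat /= evalw_cat /= !mul1g !evalw_Some.
by rewrite mulgA.
Qed.

End Words.

Section WordMetric.

Variables (G : groupType) (Sigma : finType) (inv : Sigma -> Sigma).
Variables (phi : Sigma -> G) (gens : choice_of_generators inv phi).

Local Notation len := (word_length phi).
Local Notation val := (evalw phi).
Local Notation d := (word_dist phi).

Lemma word_lengthP g : is_word_length phi g (len g).
Proof.
apply: epsilon_spec; have [_ _ _ /(_ g) [w wE]] := gens.
have [|n [[v [vn vE]] n_min]] :=
  @ex_least (fun n => exists w, size w = n /\ val w = g).
  by exists (size w), w.
by exists n; split; [exists v | move=> u uE; apply: n_min; exists u].
Qed.

Lemma geodesic_word g : exists w, val w = g /\ size w = len g.
Proof. by have [[w [? ?]] _] := word_lengthP g; exists w. Qed.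

Lemma word_length_le w : len (val w) <= size w.
Proof. by have [_ /(_ w)] := word_lengthP (val w); apply. Qed.

Lemma word_length1 : len 1%g = 0.
Proof. by have := word_length_le [::] => /=; lia. Qed.

Lemma word_lengthM g h : len (g * h)%g <= len g + len h.
Proof.
have [u [<- <-]] := geodesic_word g; have [v [<- <-]] := geodesic_word h.
by rewrite -evalw_cat -size_cat word_length_le.
Qed.

Lemma word_lengthV g : len (g^-1)%g = len g.
Proof.
have lengthV_le k : len (k^-1)%g <= len k.
  have [u [<- <-]] := geodesic_word k; have [_ _ <- _] := gens.
  by apply: leq_trans (word_length_le _) _; rewrite /winv size_rev size_map.
by apply/eqP; rewrite eqn_leq lengthV_le -{1}[g]invgK lengthV_le.
Qed.

Lemma word_distxx x : d x x = 0.
Proof. by rewrite /word_dist mulVg word_length1. Qed.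

Lemma word_distC x y : d x y = d y x.
Proof. by rewrite /word_dist -[in RHS]word_lengthV invgM invgK. Qed.

Lemma word_dist_triangle x y z : d x z <= d x y + d y z.
Proof.
rewrite /word_dist; apply: leq_trans (word_lengthM _ _).
by rewrite -mulgA mulVKg.
Qed.

Lemma word_distMl g x y : d (g * x)%g (g * y)%g = d x y.
Proof. by rewrite /word_dist invgM -mulgA mulKg. Qed.

Lemma word_dist1g g : d 1%g g = len g.
Proof. by rewrite /word_dist invg1 mul1g. Qed.

Lemma word_distg1 g : d g 1%g = len g.
Proof. by rewrite word_distC word_dist1g. Qed.

Lemma word_distgM g h : d g (g * h)%g = len h.
Proof. by rewrite /word_dist mulKg. Qed.

Lemma geodesic_prefix u v :
  len (val (u ++ v)) = size (u ++ v) -> len (val u) = size u /\ len (val v) = size v.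
Proof.
have := word_lengthM (val u) (val v); rewrite -evalw_cat size_cat.
by have := word_length_le u; have := word_length_le v; lia.
Qed.

Lemma word_dist_geodesic x y k :
  k <= d x y -> exists z, d x z = k /\ d z y = d x y - k.
Proof.
have [w [wE wS]] := geodesic_word (x^-1 * y)%g; rewrite /word_dist -wS => k_le.
have geo : len (val (take k w ++ drop k w)) = size (take k w ++ drop k w).
  by rewrite cat_take_drop wE.
exists (x * val (take k w))%g; have [uE vE] := geodesic_prefix geo.
rewrite mulKg uE size_takel //; split=> //.
rewrite -[RHS]size_drop -vE; congr word_length.
by rewrite invgM -mulgA -wE -{2}(cat_take_drop k w) evalw_cat mulKg.
Qed.

Lemma word_length_oapp_le X : len (evalw (oapp phi 1%g) X) <= size X.
Proof.
elim: X => [|[a|] X IHX] /=; first by rewrite word_length1.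
  have := word_lengthM (phi a) (evalw (oapp phi 1%g) X).
  by have := word_length_le [:: a]; rewrite /= mulg1; lia.
by rewrite mul1g ltnW.
Qed.

(** * Context-free triangles are slim *)

Section SlimTriangles.

Variables (R : language Sigma) (Gr : cfg (option Sigma)).
Hypothesis GrP : forall X, triangle_language phi R X <-> cfg_language Gr X.
Hypothesis R_combing : combing phi R.

Local Notation oval := (evalw (oapp phi 1%g)).

Definition hashes (X : seq (option Sigma)) : nat :=
  count (fun x : option Sigma => ~~ x) X.

Lemma hashes_cat X Y : hashes (X ++ Y) = hashes X + hashes Y.
Proof. exact: count_cat. Qed.

Lemma hashes_Some u : hashes (map Some u) = 0.
Proof. by elim: u. Qed.

Lemma hashes_hash_word u v w : hashes (hash_word u v w) = 2.
Proof.
rewrite /hash_word hashes_cat /= -/(hashes _) hashes_cat /= -/(hashes _).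
by rewrite !hashes_Some.
Qed.

(** Values of the maximal #-free factors, from left to right. The list is never empty, so the
    default of [head] is not reached. *)
Definition side_values : seq (option Sigma) -> seq G :=
  foldr (fun x s => if x is Some a then (phi a * head 1%g s)%g :: behead s
                    else 1%g :: s) [:: 1%g].

Lemma side_values_hash_word u v w :
  side_values (hash_word u v w) = [:: val u; val v; val w].
Proof.
have side_Some g t s : side_values s = g :: t ->
  forall z, side_values (map Some z ++ s) = (val z * g)%g :: t.
  by move=> sE; elim=> [|a z /= ->]; rewrite ?mul1g // -mulgA.
have wE : side_values (map Some w) = [:: val w].
  by rewrite -[map _ _]cats0 (side_Some 1%g [::]) ?mulg1.
rewrite /hash_word (side_Some 1%g [:: val v; val w]) ?mulg1 //=.
by rewrite (side_Some 1%g [:: val w]) ?mulg1 //= wE.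
Qed.

(** A #-free factor lies inside a single side and enters its value only through [oval]. *)
Lemma side_values_subst al be x x' :
  hashes x = 0 -> hashes x' = 0 -> oval x = oval x' ->
  side_values (al ++ x ++ be) = side_values (al ++ x' ++ be).
Proof.
have side_x z : hashes z = 0 -> side_values (z ++ be) =
    (oval z * head 1%g (side_values be))%g :: behead (side_values be).
  elim: z => [|[a|] z IHz] //=.
    by rewrite mul1g; case: be => [|[b|] be].
  by move=> /IHz ->; rewrite mulgA.
move=> hx hx' xE; have sE : side_values (x ++ be) = side_values (x' ++ be).
  by rewrite !side_x // xE.
by elim: al => [|[a|] al] //= ->.
Qed.

(** Satisfied when every side is a shortest representative in [R]. With the total length it applies
    to a subtree without locating its side. *)
Definition minimal_triangle (X : seq (option Sigma)) : Prop :=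
  forall X', triangle_language phi R X' ->
    side_values X' = side_values X -> size X <= size X'.

(* In a triangle, exchanging the yield of a nonterminal for another one keeps
   its value and its number of # signs. *)
Lemma short_yield (Q : language (option Sigma)) al be x y :
  (forall x', Q x' -> triangle_language phi R (al ++ x' ++ be)) ->
  minimal_triangle (al ++ x ++ be) -> Q x -> Q y ->
  len (oval x) <= size y /\ (hashes x = 0 -> size x <= size y).
Proof.
move=> ctx min_x Qx Qy.
have valE z : Q z -> oval z = ((oval al)^-1 * (oval be)^-1)%g.
  move=> /ctx [u [v [w [_ _ _ uvw1 zE]]]].
  have := evalw_hash_word phi u v w.
  rewrite -zE uvw1 !evalw_cat => /mulg1_eq ->.
  by rewrite mulgK.
have hashE z : Q z ->
    hashes al + hashes z + hashes be = 2.
  move=> /ctx [u [v [w [_ _ _ _ zE]]]].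
  by rewrite -addnA -!hashes_cat zE hashes_hash_word.
split.
  rewrite (valE _ Qx) -(valE _ Qy).
  exact: word_length_oapp_le.
move=> hx; have hy : hashes y = 0.
  by have := hashE _ Qx; have := hashE _ Qy; lia.
have := min_x _ (ctx _ Qy) (side_values_subst al be hy hx _).
by rewrite !size_cat (valE _ Qx) (valE _ Qy) => /(_ erefl); lia.
Qed.

(* Crossing a # at the cost of a bounded jump: in a minimal triangle the subtrees
   without # are small, and all chords have bounded length. *)
Lemma minimal_triangle_slim : exists D, forall X p p2,
  triangle_language phi R X -> minimal_triangle X -> X = p ++ p2 ->
  exists q q2, [/\ X = q ++ q2, hashes q != hashes p &
                   d (oval p) (oval q) <= D].
Proof.
have [C [C_gt0 [sym_short seq_short]]] := short_yields Gr.
(* [E] bounds the short yields of single symbols and of all sequences of at most [B] symbols, thus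
   of every tail of a right-hand side. *)
pose B := \max_(rl <- @cfg_prods _ Gr) size rl.2; pose E := B.+1 * C.
have CE : C <= E by rewrite /E mulSn leq_addr.
pose crossing (x : seq (option Sigma)) := 0 < hashes x ->
  forall p p2, x = p ++ p2 ->
  exists q q2, [/\ x = q ++ q2, hashes q != hashes p &
                   d (oval p) (oval q) <= 2 * E].
pose in_context (Q : language (option Sigma)) x := exists al be,
  (forall x', Q x' -> triangle_language phi R (al ++ x' ++ be)) /\
  minimal_triangle (al ++ x ++ be).
have short (Q : language (option Sigma)) x y : in_context Q x -> Q x -> Q y ->
    size y <= E -> len (oval x) <= E /\ (hashes x = 0 -> size x <= E).
  move=> [al [be [ctx min_x]]] Qx Qy yE.
  have [v_le s_le] := short_yield ctx min_x Qx Qy.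
  by split; [apply: leq_trans v_le yE | move=> /s_le; lia].
have [sym_crossing _] : (forall s x, gen_sym (Gr := Gr) s x ->
    in_context (gen_sym (Gr := Gr) s) x -> crossing x) /\
  (forall r x, gen_seq (Gr := Gr) r x -> size r <= B ->
    in_context (gen_seq (Gr := Gr) r) x -> crossing x).
  apply: gen_mutind.
  - move=> [a|] _ //= _ [|x [|]] // p2 pE; last first.
      by exists [::], [:: None]; move: pE => [<- _]; rewrite /= mul1g word_distxx.
    by exists [:: None], [::]; rewrite /= mul1g word_distxx.
  - move=> Y r x Yr gx IH [al [be [ctx min_x]]].
    apply: IH.
      by rewrite /B; apply: (@leq_bigmax_seq _ _ xpredT
        (fun rl : _ * seq _ => size rl.2) _ Yr).
    exists al, be; split=> // x' gx'; apply: ctx; exact: gen_nonterm gx'.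
  - by [].
  move=> s r u v gu IHu gv IHv /= r_le [al [be [ctx min_uv]]].
  have ctx_u : in_context (gen_sym (Gr := Gr) s) u.
    exists al, (v ++ be); rewrite -catA in min_uv; split=> // u' gu'.
    by rewrite [u' ++ _]catA; apply: ctx; constructor.
  have ctx_v : in_context (gen_seq (Gr := Gr) r) v.
    exists (al ++ u), be; split=> [v' gv'|]; rewrite -catA [u ++ _]catA //.
    by apply: ctx; constructor.
  have [u0 [gu0 u0_le]] := sym_short _ _ gu.
  have [v0 [gv0 v0_le]] := seq_short _ _ gv.
  have [u_len u_size] := short _ _ _ ctx_u gu gu0 (leq_trans u0_le CE).
  have [v_len v_size] : len (oval v) <= E /\ (hashes v = 0 -> size v <= E).
    apply: short ctx_v gv gv0 _; apply: leq_trans v0_le _.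
    by rewrite leq_mul2r (leqW (ltnW r_le)) orbT.
  (* If the child cut by [p] contains a #, descend into it. Otherwise it is short: leave it towards
     the other child and cross that one by its chord, at cost at most [2 * E]. *)
  move=> uv_hash p p2 /cat_eq_cat [[p' [uE p2E]]|[p' [pE vE]]].
    have [u_hash|u_hash] := eqVneq (hashes u) 0; last first.
      rewrite -lt0n in u_hash.
      have [q [q2 [uE' count_q dpq]]] := IHu ctx_u u_hash _ _ uE.
      by exists q, (q2 ++ v); rewrite uE' catA.
    exists (u ++ v), [::]; rewrite cats0; split=> //.
      move: uv_hash u_hash; rewrite hashes_cat uE !hashes_cat; lia.
    rewrite uE -catA (evalw_cat _ p) word_distgM evalw_cat.
    apply: leq_trans (word_lengthM _ _) _.
    have := u_size u_hash; rewrite uE size_cat.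
    by have := word_length_oapp_le p'; lia.
  have [v_hash|v_hash] := eqVneq (hashes v) 0; last first.
    rewrite -lt0n in v_hash.
    have [q [q2 [vE' count_q dpq]]] := IHv (ltnW r_le) ctx_v v_hash _ _ vE.
    exists (u ++ q), q2; rewrite vE' catA pE !hashes_cat !evalw_cat; split=> //.
      by rewrite eqn_add2l.
    by rewrite word_distMl.
  exists [::], (u ++ v); split=> //=.
    move: uv_hash v_hash; rewrite hashes_cat pE vE !hashes_cat; lia.
  rewrite word_distg1 pE evalw_cat; apply: leq_trans (word_lengthM _ _) _.
  rewrite mul2n -addnn leq_add //; apply: leq_trans (word_length_oapp_le _) _.
  by have := v_size v_hash; rewrite vE size_cat; apply: leq_trans (leq_addr _ _).
exists (2 * E) => X p p2 MX min_X XE.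
apply: (sym_crossing _ _ (proj1 (GrP X) MX)) XE.
  by exists [::], [::]; split=> [x' /GrP|]; rewrite /= cats0.
by case: MX => u [v [w [_ _ _ _ ->]]]; rewrite hashes_hash_word.
Qed.

Lemma hash_word_prefix (u v w : seq Sigma) q q2 : hash_word u v w = q ++ q2 ->
  [\/ exists u1 u2, u = u1 ++ u2 /\ q = map Some u1,
      exists v1 v2, v = v1 ++ v2 /\ q = map Some u ++ None :: map Some v1 |
      exists w1 w2, w = w1 ++ w2 /\
        q = map Some u ++ None :: map Some v ++ None :: map Some w1].
Proof.
rewrite /hash_word => /cat_eq_cat [[r [uE _]]|[r [-> rE]]].
  by have [u1 [u2 [? ? _]]] := map_eq_cat uE; constructor 1; exists u1, u2.
case: r rE => [_|_ r [<- /cat_eq_cat [[r' [vE _]]|[r' [-> rE]]]]].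
- by constructor 1; exists u, [::]; rewrite !cats0.
- have [v1 [v2 [? <- _]]] := map_eq_cat vE.
  by constructor 2; exists v1, v2.
case: r' rE => [_|_ r' [<- wE]].
  by constructor 2; exists v, [::]; rewrite !cats0.
by have [w1 [w2 [? <- _]]] := map_eq_cat wE; constructor 3; exists w1, w2.
Qed.

Let shortest_rep g u := [/\ R u, val u = g &
  forall w, R w -> val w = g -> size u <= size w].

Lemma shortest_repP g : exists u, shortest_rep g u.
Proof.
have [w [Rw wE]] := R_combing g.
have [|n [[u [Ru uE <-]] u_min]] :=
  @ex_least (fun n => exists u, [/\ R u, val u = g & size u = n]).
  by exists (size w), w.
by exists u; split=> // v Rv vE; apply: u_min; exists v.
Qed.

Let rep g := epsilon (inhabits [::]) (shortest_rep g).

Let rep_spec g : shortest_rep g (rep g).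
Proof. by apply: epsilon_spec; exact: shortest_repP. Qed.

Let val_rep g : val (rep g) = g.
Proof. by case: (rep_spec g). Qed.

(** Not symmetric in [x] and [y]: the representative of an inverse need not be the inverse word.
    Slimness therefore comes first for cyclically oriented triangles. *)
Let on_line x y p := exists u1 u2,
  rep (x^-1 * y)%g = u1 ++ u2 /\ p = (x * val u1)%g.

(** Letters are dropped from the end of the path until a point with [P] is met, at [x] at the
    latest; until then the end points satisfy [Q]. *)
Lemma on_line_connected x y (P Q : G -> Prop) :
  (forall p, on_line x y p -> P p \/ Q p) -> P x -> Q y ->
  exists p q, [/\ on_line x y p, on_line x y q, P p, Q q & d p q <= 1].
Proof.
rewrite /on_line; move=> PQ Px; rewrite -{1}(mulVKg x y) -{1}(val_rep (x^-1 * y)).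
move: PQ Px; move: (rep (x^-1 * y)%g) => u.
elim/last_ind: u => [|u a IHu] PQ Px.
  rewrite mulg1 => Qx; exists x, x.
  by split=> //; [exists [::], [::]..|]; rewrite ?mulg1 ?word_distxx.
have [] := PQ (x * val u)%g; first by exists u, [:: a]; rewrite cats1.
  move=> Pu Qua; exists (x * val u)%g, (x * val (rcons u a))%g; split=> //.
  - by exists u, [:: a]; rewrite cats1.
  - by exists (rcons u a), [::]; rewrite cats0.
  rewrite word_distMl evalw_rcons word_distgM -[phi a]mulg1.
  exact: (word_length_le [:: a]).
move=> Qu _; have [||//|p [q [[u1 [u2 [uE pE]]] [v1 [v2 [vE qE]]] ? ? ?]]] := IHu.
- move=> p [u1 [u2 [uE pE]]]; apply: PQ.
  by exists u1, (rcons u2 a); rewrite uE rcons_cat.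
- by [].
exists p, q; split=> //; [exists u1, (rcons u2 a)|exists v1, (rcons v2 a)].
  by rewrite uE rcons_cat.
by rewrite vE rcons_cat.
Qed.

Lemma on_line_cyclic_slim : exists D, forall x y z p, on_line x y p ->
  exists q, (on_line y z q \/ on_line z x q) /\ d p q <= D.
Proof.
have [D slim] := minimal_triangle_slim; exists D => x y z p [u1 [u2 [uE ->]]].
have [Rg _ g_min] := rep_spec (x^-1 * y)%g.
have [Rh _ h_min] := rep_spec (y^-1 * z)%g.
have [Rk _ k_min] := rep_spec (z^-1 * x)%g.
pose X := hash_word (rep (x^-1 * y)%g) (rep (y^-1 * z)%g) (rep (z^-1 * x)%g).
have MX : triangle_language phi R X.
  exists (rep (x^-1 * y)%g), (rep (y^-1 * z)%g), (rep (z^-1 * x)%g).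
  by split=> //; rewrite !val_rep -!mulgA !mulVKg mulVg.
have min_X : minimal_triangle X.
  move=> _ [u [v [w [Ru Rv Rw _ ->]]]].
  rewrite !side_values_hash_word !val_rep => -[uE' vE' wE'].
  rewrite /X /hash_word !size_cat /= !size_cat /= !size_map.
  have := g_min _ Ru uE'; have := h_min _ Rv vE'; have := k_min _ Rw wE'; lia.
have XE : X = map Some u1 ++ map Some u2 ++ None ::
    map Some (rep (y^-1 * z)%g) ++ None :: map Some (rep (z^-1 * x)%g).
  by rewrite /X /hash_word uE map_cat catA.
(* The prefix [map Some u1] has no #, so [q] has one and ends on another side. Values of prefixes
   are positions relative to [x]. *)
have [q [q2 [/hash_word_prefix qE hash_q]]] := slim _ _ _ MX min_X XE.
rewrite evalw_Some => dpq.
case: qE hash_q dpq => [[v1 [v2 [_ ->]]]|[v1 [v2 [vE ->]]] _|[v1 [v2 [vE ->]]] _].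
- by rewrite !hashes_Some.
- rewrite evalw_cat /= mul1g !evalw_Some val_rep => dpq.
  exists (y * val v1)%g; split; first by left; exists v1, v2.
  by rewrite -(word_distMl x^-1) mulKg mulgA.
rewrite evalw_cat /= evalw_cat /= !mul1g !evalw_Some !val_rep => dpq.
exists (z * val v1)%g; split; first by right; exists v1, v2.
by rewrite -(word_distMl x^-1) mulKg; move: dpq; rewrite -!mulgA mulVKg.
Qed.

Lemma rep_bounded : exists B, forall g, len g <= 1 -> size (rep g) <= B.
Proof.
exists (size (rep 1%g) + \max_a size (rep (phi a))) => g.
have [[|a [|b u]] [<- <-]] := geodesic_word g => //= _; first exact: leq_addr.
by rewrite mulg1 (leq_trans _ (leq_addl _ _)) // leq_bigmax.
Qed.

Theorem slim_combing_hyperbolic : word_hyperbolic phi.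
Proof.
have [D slim] := on_line_cyclic_slim; have [B rep_B] := rep_bounded.
have near_source x y p : len (x^-1 * y)%g <= 1 -> on_line x y p -> d p x <= B.
  move=> xy [u1 [u2 [uE ->]]]; rewrite word_distC word_distgM.
  apply: leq_trans (word_length_le _) _; apply: leq_trans _ (rep_B _ xy).
  by rewrite uE size_cat leq_addr.
(* The degenerate triangle [z], [x], [z] compares a line with its reverse; its third side is the
   representative of 1, which is bounded. *)
have reverse x z p : on_line z x p -> exists q, on_line x z q /\ d p q <= D + B.
  move=> /(slim _ _ z) [q [[xzq|zzq] dpq]]; first by exists q; split; last lia.
  exists z; split.
    by exists (rep (x^-1 * z)%g), [::]; rewrite cats0 val_rep mulVKg.
  have := near_source z z q _ zzq; rewrite mulVg word_length1 => /(_ isT).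
  by have := word_dist_triangle p q z; lia.
have [||delta deltaP] := @guessing_geodesics G d on_line (2 * D + 2 * B)
    word_distxx word_distC word_dist_triangle word_dist_geodesic
    on_line_connected _ _; last by exists delta.
- move=> x y z p /(slim _ _ z) [q [[yzq|zxq] dpq]].
    have [r [zyr dqr]] := reverse _ _ _ yzq.
    exists r; split; first by right.
    by have := word_dist_triangle p q r; lia.
  have [r [xzr dqr]] := reverse _ _ _ zxq.
  exists r; split; first by left.
  by have := word_dist_triangle p q r; lia.
by move=> x y p /near_source near /near; lia.
Qed.

End SlimTriangles.

(** * A grammar for thin polygons *)

Section ThinWords.

Variable K : nat.

Local Notation oval := (evalw (oapp phi 1%g)).

(* A thin word labels a path which, closed up by a chord, bounds a polygon that can
   be cut into triangles by chords of length at most K. *)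
Inductive thin : seq (option Sigma) -> Prop :=
  | thin_letter x : len (oval [:: x]) <= K -> thin [:: x]
  | thin_cat X Y : thin X -> thin Y -> len (oval (X ++ Y)) <= K -> thin (X ++ Y).

Variable D : dfa (option Sigma).

Local Notation run := (foldl (@dfa_trans _ D)).

(** Words of length at most [K] encode the ball of radius [K]: they form a finite type, and an
    element may have several codes. *)
Definition chord : finType := (dfa_state D * K.-bseq Sigma * dfa_state D)%type.

Definition start_rules : seq (option chord * seq (option Sigma + option chord)) :=
  [seq (None, [:: inr (Some c)]) | c in [pred c : chord |
     [&& c.1.1 == dfa_start D, dfa_accept c.2 & val c.1.2 == 1%g]]].

Definition letter_rules : seq (option chord * seq (option Sigma + option chord)) :=
  [seq (Some u.1, [:: inl u.2]) | u in [pred u : chord * option Sigma |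
     (dfa_trans u.1.1.1 u.2 == u.1.2) && (val u.1.1.2 == oval [:: u.2])]].

Definition cat_rules : seq (option chord * seq (option Sigma + option chord)) :=
  [seq (Some t.1.1, [:: inr (Some t.1.2); inr (Some t.2)]) |
     t in [pred t : chord * chord * chord |
     [&& t.1.1.1.1 == t.1.2.1.1, t.1.2.2 == t.2.1.1, t.2.2 == t.1.1.2 &
         val t.1.1.1.2 == (val t.1.2.1.2 * val t.2.1.2)%g]]].

Definition thin_cfg : cfg (option Sigma) :=
  Cfg None (start_rules ++ letter_rules ++ cat_rules).

Definition sym_sound (s : option Sigma + option chord) X : Prop :=
  match s with
  | inl x => X = [:: x]
  | inr None => dfa_accepts D X /\ oval X = 1%g
  | inr (Some c) => run c.1.1 X = c.2 /\ oval X = val c.1.2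
  end.

Fixpoint seq_sound (r : seq (option Sigma + option chord)) X : Prop :=
  if r is s :: r' then exists u v, [/\ X = u ++ v, sym_sound s u & seq_sound r' v]
  else X = [::].

Lemma thin_cfg_sound :
  (forall s X, gen_sym (Gr := thin_cfg) s X -> sym_sound s X) /\
  (forall r X, gen_seq (Gr := thin_cfg) r X -> seq_sound r X).
Proof.
apply: gen_mutind => //= [Y r X|s r u v _ su _ rv]; last by exists u, v.
rewrite !mem_cat => /or3P[] /imageP[].
- move=> [[p b] q] /and3P[/= /eqP-> qF /eqP b1] [-> ->] _.
  move=> [u [_ [-> [uq ub] ->]]]; rewrite cats0 ub b1.
  by rewrite /dfa_accepts uq.
- move=> [[[p b] q] x] /andP[/= /eqP pq /eqP bE] [-> ->] _.
  by move=> [_ [_ [-> -> ->]]] /=; rewrite pq bE.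
move=> [[[[p b] q] [[p1 b1] q1]] [[p2 b2] q2]].
move=> /and4P[/= /eqP-> /eqP<- /eqP<- /eqP bE] [-> ->] _.
move=> [u [_ [-> [uq ub] [v [_ [-> [vq vb] ->]]]]]] /=.
by rewrite cats0 foldl_cat uq vq evalw_cat ub vb.
Qed.

Lemma thin_short X : thin X -> len (oval X) <= K.
Proof. by case. Qed.

Lemma short_bseq g : len g <= K -> exists b : K.-bseq Sigma, val b = g.
Proof.
by have [w [wE <-]] := geodesic_word g => w_le; exists (Bseq w_le).
Qed.

(** Each cut of a thin word becomes one of the [cat_rules]. State and code are arbitrary because the
    parent chord prescribes them. *)
Lemma thin_cfg_complete X : thin X -> forall p (b : K.-bseq Sigma),
  val b = oval X -> gen_sym (Gr := thin_cfg) (inr (Some (p, b, run p X))) X.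
Proof.
have gen1 (s : option Sigma + cfg_nt thin_cfg) Y :
    gen_sym s Y -> gen_seq [:: s] Y.
  by move=> gY; rewrite -[Y]cats0; apply: gen_cons gY _; constructor.
elim=> [x _|Y Z thinY IHY thinZ IHZ _] p b bE.
  apply: (@gen_nonterm _ _ _ [:: inl x]); last by apply: gen1; constructor.
  rewrite !mem_cat; apply/or3P/Or32/imageP; exists (p, b, dfa_trans p x, x) => //=.
  by apply/andP; rewrite /= bE !eqxx.
have [b1 b1E] := short_bseq (thin_short thinY).
have [b2 b2E] := short_bseq (thin_short thinZ).
rewrite foldl_cat; set q := run p Y.
apply: (@gen_nonterm _ thin_cfg (Some (p, b, run q Z))
  [:: inr (Some (p, b1, q)); inr (Some (q, b2, run q Z))]).
  rewrite !mem_cat; apply/or3P/Or33/imageP.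
  exists (p, b, run q Z, (p, b1, q), (q, b2, run q Z)) => //=.
  by apply/and4P; rewrite /= bE b1E b2E evalw_cat !eqxx.
by constructor; [exact: IHY | apply/gen1/IHZ].
Qed.

Lemma context_free_thin (L : language (option Sigma)) :
  (forall X, L X <-> dfa_accepts D X /\ oval X = 1%g) ->
  (forall X, L X -> thin X) -> context_free L.
Proof.
move=> LP L_thin; exists thin_cfg => X; split; last first.
  by move=> /(proj1 thin_cfg_sound) /LP.
move=> LX; have [XF X1] := proj1 (LP X) LX.
have b0_short : len 1%g <= K by rewrite word_length1.
have [b bE] := short_bseq b0_short.
pose c : chord := (dfa_start D, b, run (dfa_start D) X).
rewrite -[X]cats0.
apply: (@gen_nonterm _ thin_cfg None [:: inr (Some c)]).
  rewrite !mem_cat; apply/or3P/Or31/imageP.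
  exists c => //.
  by apply/and3P; rewrite /= bE !eqxx.
constructor; last by constructor.
by apply: thin_cfg_complete; [apply: L_thin | rewrite bE X1].
Qed.

End ThinWords.

(** * Enlarging thin words letter by letter *)

Section ThinExtension.

Variable K : nat.

Local Notation oval := (evalw (oapp phi 1%g)).

Lemma thin_Some a : 0 < K -> thin K [:: Some a].
Proof.
by move=> K_gt0; constructor; apply: leq_trans (word_length_oapp_le _) _.
Qed.

(** [c] is the middle letter that rounding may leave on a side of a triangle. The strict bound on
    [X] leaves room for the longer chord. *)
Lemma thin_letter_l c X : size c <= 1 -> thin K X -> len (oval X) < K ->
  thin K (map Some c ++ X) /\ len (oval (map Some c ++ X)) <= (len (oval X)).+1.
Proof.
move=> c_le X_thin X_lt.
have len_le : len (oval (map Some c ++ X)) <= (len (oval X)).+1.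
  rewrite evalw_cat evalw_Some; apply: leq_trans (word_lengthM _ _) _.
  by have := word_length_le c; lia.
split=> //; case: c c_le len_le => [|a [|//]] // _ len_le.
apply: thin_cat => //; last exact: leq_trans X_lt.
by apply: thin_Some; lia.
Qed.

Lemma thin_letter_r c X : size c <= 1 -> thin K X -> len (oval X) < K ->
  thin K (X ++ map Some c) /\ len (oval (X ++ map Some c)) <= (len (oval X)).+1.
Proof.
move=> c_le X_thin X_lt.
have len_le : len (oval (X ++ map Some c)) <= (len (oval X)).+1.
  rewrite evalw_cat evalw_Some; apply: leq_trans (word_lengthM _ _) _.
  by have := word_length_le c; lia.
split=> //; case: c c_le len_le => [|a [|//]] // _ len_le; first by rewrite cats0.
apply: thin_cat => //; last exact: leq_trans X_lt.
by apply: thin_Some; lia.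
Qed.

(** From the inside outwards, a letter is added on the left and then on the right. The hypothesis
    bounds chords between symmetric points; its strictness allows the chord in between. *)
Lemma thin_sandwich X y z : thin K X -> size y = size z ->
  (forall t, t <= size y ->
     len (val (drop (size y - t) y) * oval X * val (take t z))%g < K) ->
  thin K (map Some y ++ X ++ map Some z).
Proof.
move=> X_thin; elim: y z => [|a y IHy] z; first by case: z => //=; rewrite cats0.
case/lastP: z => [|z b]; rewrite ?size_rcons //= => -[yz] short.
have in_thin : thin K (map Some y ++ X ++ map Some z).
  apply: IHy => // t t_le; have := short t (leqW t_le).
  by rewrite subSn //= -cats1 takel_cat // -yz.
have in_short : len (oval (map Some y ++ X ++ map Some z)) < K.
  have := short (size y) (leqnSn _).
  rewrite subSn // subnn /= drop0 -cats1 takel_cat ?yz // take_size.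
  by rewrite !evalw_cat !evalw_Some mulgA.
have [ay_thin ay_short] := @thin_letter_l [:: a] _ isT in_thin in_short.
suff: thin K ((map Some [:: a] ++ map Some y ++ X ++ map Some z) ++ map Some [:: b]).
  by rewrite -cats1 map_cat /= -!catA.
apply: thin_cat => //; first by apply: thin_Some; lia.
have := short (size y).+1 (leqnn _); rewrite subnn drop0 take_oversize.
  by rewrite -cats1 !evalw_cat !evalw_Some /= !mulg1 !mulgA; apply: ltnW.
by rewrite size_rcons yz.
Qed.

End ThinExtension.

(** * Geodesics in a hyperbolic group *)

Section Hyperbolic.

Variable delta : nat.
Hypothesis hyp : forall x y z w,
  minn (gromov2 phi x y w) (gromov2 phi y z w) <= gromov2 phi x z w + 2 * delta.

Lemma four_point x y z m :
  m <= len x + len y - d x y -> m <= len y + len z - d y z ->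
  m <= len x + len z - d x z + 2 * delta.
Proof.
by move=> xy yz; have := hyp x y z 1%g; rewrite /gromov2 !word_distg1; lia.
Qed.

Definition geodesic (w : seq Sigma) : Prop := len (val w) = size w.

Lemma geodesic_dist u v : geodesic (u ++ v) ->
  [/\ len (val u) = size u, len (val (u ++ v)) = size u + size v &
      d (val u) (val (u ++ v)) = size v].
Proof.
move=> uv; have [uS vS] := geodesic_prefix uv.
by split=> //; rewrite ?uv ?size_cat // evalw_cat word_distgM.
Qed.

(* A shorter path to val (w' ++ rcons v a) would pass close to val w', through a
   point closer to 1; translating its last part gives a shorter path to
   val (w ++ rcons v a). *)
Lemma cone_determined w w' v :
  (forall b, size b <= 4 * delta + 1 ->
     len (val w * val b)%g + size w' = len (val w' * val b)%g + size w) ->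
  geodesic w' -> geodesic (w ++ v) -> geodesic (w' ++ v).
Proof.
move=> ball w'_geo; elim/last_ind: v => [|v a IHv] wva_geo; first by rewrite cats0.
have wv_geo : geodesic (w ++ v).
  by move: wva_geo; rewrite /geodesic -cats1 catA => /geodesic_prefix [].
have {IHv} w'v_geo := IHv wv_geo.
have [w'_len w'v_len w'v_dist] := geodesic_dist w'v_geo.
apply/eqP; rewrite eqn_leq word_length_le leqNgt; apply/negP.
rewrite size_cat size_rcons => short.
have [g [gE g_size]] := geodesic_word (val (w' ++ rcons v a)).
have dist_a : d (val (w' ++ v)) (val (w' ++ rcons v a)) <= 1.
  rewrite -cats1 catA [val (_ ++ [:: a])]evalw_cat word_distgM.
  exact: word_length_le.
have g_long : size w' + size v <= size g + 1.
  have := word_dist_triangle (val (w' ++ rcons v a)) (val (w' ++ v)) 1%g.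
  have := word_dist_triangle (val (w' ++ v)) (val (w' ++ rcons v a)) 1%g.
  by rewrite !word_distg1; lia.
(* For empty [w'] the word is a suffix of the geodesic [w ++ rcons v a]. *)
case: (posnP (size w')) => [/size0nil w'0|w'_pos].
  move: short; rewrite w'0 /=; have [_] := geodesic_prefix wva_geo.
  by rewrite size_rcons => ->; rewrite ltnn.
pose n := (size w').-1; pose g1 := take n g; pose g2 := drop n g.
have g_cat : g = g1 ++ g2 by rewrite cat_take_drop.
have g1_size : size g1 = n by rewrite size_takel /n //; lia.
have g_geo : geodesic (g1 ++ g2) by rewrite /geodesic -g_cat gE g_size.
have [g1_len _ g1_dist] := geodesic_dist g_geo.
rewrite -g_cat gE in g1_dist.
have [b [bE b_size]] := geodesic_word ((val w')^-1 * val g1)%g.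
have b_small : size b <= 4 * delta + 1.
  (* In the chain [w'], [w' ++ v], [w' ++ rcons v a], [g1], neighbors have doubled Gromov product at
     least [2 * n] at 1. Two four-point inequalities lose [4 * delta], and [size w' = n.+1] adds the
     1. *)
  have far1 : 2 * n - 2 * delta <= len (val w') + len (val (w' ++ rcons v a)) -
       d (val w') (val (w' ++ rcons v a)).
    rewrite leq_subLR addnC; apply: (@four_point _ (val (w' ++ v))).
      by rewrite w'_len w'v_len w'v_dist /n; lia.
    by rewrite w'v_len -g_size; lia.
  have := four_point (z := val g1) far1.
  rewrite -g_size word_distC g1_dist g1_len g1_size /word_dist.
  have g2_size : size g2 = size g - n by rewrite size_drop.
  rewrite g2_size -b_size.
  have := word_dist_triangle (val w') 1%g (val g1).
  rewrite word_distg1 word_dist1g g1_len g1_size w'_len /word_dist -b_size.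
  have : n.+1 = size w' by rewrite /n prednK.
  by move=> ? ? /(_ ltac:(lia)); lia.
(* So [val w * val b] has length [size w - 1], and continuing with [g2] is too short for the
   geodesic [w ++ rcons v a]. *)
have := ball b b_small; rewrite bE mulVKg g1_len g1_size => wb_len.
have vaE : val (rcons v a) = (val b * val g2)%g.
  apply: (mulgI (val w')); rewrite -evalw_cat -gE g_cat evalw_cat bE.
  by rewrite -!mulgA mulVKg.
have := word_lengthM (val w * val b)%g (val g2).
rewrite -mulgA -vaE -(evalw_cat phi w (rcons v a)) wva_geo size_cat size_rcons bE.
have := word_length_le g2; rewrite size_drop.
have : n.+1 = size w' by rewrite /n prednK.
by move: wb_len short; rewrite -g_size; lia.
Qed.

(** There are finitely many cone types. Nongeodesic words share the color [None], since none of them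
    has a geodesic extension. *)
Lemma geodesics_regular : regular geodesic.
Proof.
pose K := 4 * delta + 1.
pose color (w : seq Sigma) : option {ffun K.-bseq Sigma -> 'I_(2 * K).+1} :=
  if len (val w) == size w
  then Some [ffun b : K.-bseq Sigma =>
               (* The length difference lies between [-K] and [K]; adding [K] makes it natural. *)
               inord (len (val w * val b)%g + K - len (val w))]
  else None.
apply: (regular_of_coloring (color := color)).
suff half u v w : color u = color v -> geodesic (u ++ w) -> geodesic (v ++ w).
  by move=> u v uv w; split; apply: half.
move=> uv uw_geo; move: uv; rewrite /color.
have [-> _] := geodesic_prefix uw_geo; rewrite eqxx.
case: eqP => // v_geo [/ffunP uv].
apply: (cone_determined (w := u)) => // b b_le.
have [u_geo _] := geodesic_prefix uw_geo.
have near z : len (z * val b)%g <= len z + K /\ len z <= len (z * val b)%g + K.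
  have := word_length_le b; have := word_lengthM (z * val b)%g (val b)^-1.
  by have := word_lengthM z (val b); rewrite mulgK word_lengthV; lia.
have [u1 u2] := near (val u); have [v1 v2] := near (val v).
have := congr1 (@nat_of_ord _) (uv (Bseq b_le)); rewrite !ffunE /=.
rewrite !inordK; lia.
Qed.

End Hyperbolic.

(** * Thinness of geodesic triangles *)

Section ThinGeodesicTriangles.

Variable delta : nat.
Hypothesis hyp : forall x y z w,
  minn (gromov2 phi x y w) (gromov2 phi y z w) <= gromov2 phi x z w + 2 * delta.

Let four_point_hyp := four_point hyp.

(** Fellow traveling up to the Gromov product: the points at distance [t] from the corner are
    compared through the far ends of the two sides, by two four-point inequalities. *)
Lemma geodesic_corner u v t : geodesic u -> geodesic v ->
  t <= size u -> t <= size v ->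
  2 * t + len (val u * val v)%g <= size u + size v ->
  len (val (drop (size u - t) u) * val (take t v))%g <= 4 * delta.
Proof.
move=> u_geo v_geo t_u t_v t_small.
pose u1 := take (size u - t) u; pose u2 := drop (size u - t) u.
have uE : u = u1 ++ u2 by rewrite cat_take_drop.
have u_geo' : geodesic (u1 ++ u2) by rewrite -uE.
have [u1_len u2_len] := geodesic_prefix u_geo'.
have vE : v = take t v ++ drop t v by rewrite cat_take_drop.
have v_geo' : geodesic (take t v ++ drop t v) by rewrite -vE.
have [v1_len _ v1_dist] := geodesic_dist v_geo'; rewrite -vE in v1_dist.
have u1_size : size u1 = size u - t by rewrite size_takel // leq_subr.
have u2_size : size u2 = t by rewrite size_drop; lia.
have v1_size : size (take t v) = t by rewrite size_takel.
have pa : d (val u2)^-1%g (val u)^-1%g = size u - t.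
  rewrite /word_dist invgK uE evalw_cat invgM mulVKg word_lengthV.
  by rewrite u1_len size_cat u2_size addnK.
have ac : d (val u)^-1%g (val v) = len (val u * val v)%g.
  by rewrite /word_dist invgK.
have far : 2 * t - 2 * delta <=
    len (val u2)^-1%g + len (val v) - d (val u2)^-1%g (val v).
  rewrite leq_subLR addnC; apply: (four_point_hyp (y := (val u)^-1%g)).
    by rewrite !word_lengthV u2_len u2_size u_geo pa; lia.
  by rewrite word_lengthV ac u_geo v_geo; lia.
have := four_point_hyp (z := val (take t v)) far.
rewrite word_lengthV u2_len u2_size v_geo v1_len v1_size.
rewrite word_distC v1_dist size_drop /word_dist invgK.
have := word_lengthM (val u2) (val (take t v)).
rewrite u2_len v1_len u2_size v1_size.
rewrite -/u2; move: (len _) => L.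
by clear -t_v; lia.
Qed.

Lemma thin_geodesic_corner K u v i : 4 * delta < K ->
  geodesic u -> geodesic v -> i <= size u -> i <= size v ->
  2 * i + len (val u * val v)%g <= size u + size v ->
  thin K (map Some (drop (size u - i) u) ++ [:: None] ++ map Some (take i v)).
Proof.
move=> K_big u_geo v_geo i_u i_v i_small.
have u2_size : size (drop (size u - i) u) = i by rewrite size_drop; lia.
apply: thin_sandwich => [||t].
- by constructor; rewrite /= mul1g word_length1.
- by rewrite u2_size size_takel.
rewrite u2_size => t_le; rewrite /= !mulg1 drop_drop take_takel //.
rewrite (_ : i - t + (size u - i) = size u - t); last by lia.
by apply: leq_ltn_trans K_big; apply: geodesic_corner => //; lia.
Qed.

Lemma middle_letter (s : seq Sigma) a b : a + b <= size s <= a + b + 1 ->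
  exists c, size c <= 1 /\ s = take a s ++ c ++ drop (size s - b) s.
Proof.
move=> ab; exists (drop a (take (size s - b) s)); split.
  by rewrite size_drop size_takel; lia.
rewrite -{1}(cat_take_drop (size s - b) s).
by rewrite -{1}(cat_take_drop a (take (size s - b) s)) take_takel ?catA //; lia.
Qed.

Lemma hash_word_split (u1 u2 u3 v1 v2 v3 w1 w2 w3 : seq Sigma) :
  hash_word (u1 ++ u2 ++ u3) (v1 ++ v2 ++ v3) (w1 ++ w2 ++ w3) =
  map Some u1 ++
  (((map Some u2 ++ map Some u3 ++ [:: None] ++ map Some v1) ++ map Some v2) ++
   (map Some v3 ++ [:: None] ++ map Some w1) ++ map Some w2) ++
  map Some w3.
Proof. by rewrite /hash_word !map_cat -!catA. Qed.

(* The three inscribed points, at distances given by the Gromov products from the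
   corners, cut a geodesic triangle into three corners and a central hexagon
   three of whose sides have length at most 1. *)
Lemma thin_geodesic_triangle K u v w : 4 * delta + 3 <= K ->
  geodesic u -> geodesic v -> geodesic w -> (val u * val v * val w = 1)%g ->
  thin K (hash_word u v w).
Proof.
move=> K_big u_geo v_geo w_geo uvw1.
have wE := mulg1_eq uvw1.
have uv_len : len (val u * val v)%g = size w.
  by rewrite -w_geo -wE word_lengthV.
have vw_len : len (val v * val w)%g = size u.
  have /mulg1_eq <- : (val u * (val v * val w) = 1)%g by rewrite mulgA.
  by rewrite word_lengthV.
have wu_len : len (val w * val u)%g = size v.
  by rewrite -wE invgM mulgVK word_lengthV.
have := word_lengthM (val u) (val v); have := word_lengthM (val v) (val w).
have := word_lengthM (val w) (val u).
rewrite uv_len vw_len wu_len u_geo v_geo w_geo => w_u v_w u_v.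
(* Halves are rounded down, so each side keeps one middle letter if the perimeter is odd. *)
pose i := (size u + size v - size w)./2; pose j := (size v + size w - size u)./2.
pose k := (size w + size u - size v)./2.
have [ki_u ij_v jk_w] : [/\ k + i <= size u <= k + i + 1,
  i + j <= size v <= i + j + 1 & j + k <= size w <= j + k + 1].
  by rewrite /i /j /k; split; lia.
have [i_small j_small k_small] : [/\ 2 * i + size w <= size u + size v,
  2 * j + size u <= size v + size w & 2 * k + size v <= size w + size u].
  by rewrite /i /j /k; split; lia.
move: i j k ki_u ij_v jk_w i_small j_small k_small => i j k ki_u ij_v jk_w.
move=> i_small j_small k_small.
have [u' [u'_small uE]] := middle_letter ki_u.
have [v' [v'_small vE]] := middle_letter ij_v.
have [w' [w'_small wE']] := middle_letter jk_w.
pose B := map Some (drop (size u - i) u) ++ [:: None] ++ map Some (take i v).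
pose C := map Some (drop (size v - j) v) ++ [:: None] ++ map Some (take j w).
have B_thin : thin K B by apply: thin_geodesic_corner => //; rewrite ?uv_len; lia.
have C_thin : thin K C by apply: thin_geodesic_corner => //; rewrite ?vw_len; lia.
have B_short : len (evalw (oapp phi 1%g) B) <= 4 * delta.
  rewrite !evalw_cat /= !evalw_Some !mul1g.
  by apply: geodesic_corner => //; rewrite ?uv_len; lia.
have C_short : len (evalw (oapp phi 1%g) C) <= 4 * delta.
  rewrite !evalw_cat /= !evalw_Some !mul1g.
  by apply: geodesic_corner => //; rewrite ?vw_len; lia.
have [] := @thin_letter_l K u' B=> //; try lia.
move=> uB_thin uB_short.
have [] := @thin_letter_r K v' (map Some u' ++ B)=> //; try lia.
move=> uBv_thin _.
have [] := @thin_letter_r K w' C=> //; try lia.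
move=> Cw_thin _.
(* The central hexagon together with the corners [B] and [C]; the legs of the third corner will
   enclose it. *)
pose X := ((map Some u' ++ B) ++ map Some v') ++ C ++ map Some w'.
have hash_wordE : hash_word u v w =
    map Some (take k u) ++ X ++ map Some (drop (size w - k) w).
  by rewrite [in LHS]uE [in LHS]vE [in LHS]wE' hash_word_split.
have X_thin : len (evalw (oapp phi 1%g) X) <= K -> thin K X by exact: thin_cat.
move: X hash_wordE X_thin => X hash_wordE X_thin.
(* The whole word has value 1, so this chord is inverse to the complementary word, read around the
   third corner from [w] to [u], where [geodesic_corner] applies. *)
have X_short t : t <= k -> len (val (drop (k - t) (take k u)) *
    evalw (oapp phi 1%g) X * val (take t (drop (size w - k) w)))%g <= 4 * delta.
  move=> t_le; set inner := (_ * _ * _)%g.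
  have /mulg1_eq innerE : (val (take (k - t) u) *
      (inner * val (drop (size w - (k - t)) w)) = 1)%g.
    have := evalw_hash_word phi u v w; rewrite uvw1 hash_wordE => <-.
    rewrite !evalw_cat !evalw_Some -{1}(cat_take_drop (k - t) (take k u)).
    rewrite -{1}(cat_take_drop t (drop (size w - k) w)) drop_drop.
    rewrite (_ : t + (size w - k) = size w - (k - t)); last by lia.
    by rewrite take_takel ?leq_subr // !evalw_cat /inner !mulgA.
  have -> : inner = (val (drop (size w - (k - t)) w) * val (take (k - t) u))^-1%g.
    by rewrite invgM innerE mulgK.
  by rewrite word_lengthV; apply: geodesic_corner => //; rewrite ?wu_len; lia.
have k_size : size (take k u) = k by rewrite size_takel; lia.
rewrite hash_wordE; apply: thin_sandwich.
- apply: X_thin; have := X_short 0 (leq0n _).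
  by rewrite subn0 -{1}k_size drop_size take0 /= mul1g mulg1; lia.
- by rewrite size_drop k_size; lia.
by rewrite k_size => t t_le; have := X_short t t_le; lia.
Qed.

End ThinGeodesicTriangles.

Lemma hyperbolic_geodesic_triangles : word_hyperbolic phi ->
  regular_combing phi geodesic /\
  context_free (triangle_language phi geodesic).
Proof.
move=> [delta hyp]; have [D DP] := geodesics_regular hyp.
split; first split; first by exists D.
  by move=> g; have [w [<- wS]] := geodesic_word g; exists w.
apply: (@context_free_thin (4 * delta + 3) (hash_dfa D)) => X; last first.
  by move=> [u [v [w [? ? ? ? ->]]]]; exact: thin_geodesic_triangle.
rewrite hash_dfaP; split.
  move=> [u [v [w [/DP ? /DP ? /DP ? uvw1 ->]]]].
  by rewrite evalw_hash_word; split=> //; exists u, v, w.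
move=> [[u [v [w [/DP ? /DP ? /DP ? ->]]]]]; rewrite evalw_hash_word => uvw1.
by exists u, v, w.
Qed.

End WordMetric.

Theorem theorem1p1 (G : groupType) (Sigma : finType)
    (inv : Sigma -> Sigma) (phi : Sigma -> G) :
  choice_of_generators inv phi ->
  (word_hyperbolic phi <->
   exists R : language Sigma,
     regular_combing phi R /\ context_free (triangle_language phi R)).
Proof.
move=> gens; split=> [hyp|[R [[_ R_combing] [Gr GrP]]]].
  by exists (geodesic phi); apply: (hyperbolic_geodesic_triangles gens).
exact: (slim_combing_hyperbolic gens GrP R_combing).
Qed.
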